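(* Let $k\ge1$. If $\mathcal H\subseteq\mathrm{FIN}_k^{\infty}$ is a semiselective coideal, then $\mathbb M_{\mathcal H}$ has the pure decision property: for every sentence $\varphi$ of the forcing language and every condition $(s,A)\in\mathbb M_{\mathcal H}$ there is $B\in\mathcal H$ with $B\le A$ such that $(s,B)$ decides $\varphi$.
   Context: $\mathrm{FIN}_k$ is the set of $p:\mathbb N\to\{0,\dots,k\}$ with finite support $\mathrm{supp}(p)=\{n:p(n)\ne0\}$ and $k$ in the range; $p<q$ means $\max\mathrm{supp}(p)<\min\mathrm{supp}(q)$. $\mathrm{FIN}_k^\infty$ / $\mathrm{FIN}_k^{<\infty}$: infinite / finite block sequences $(p_n)$ with $p_n<p_{n+1}$; $\mathrm{FIN}_k^{[d]}$: those of length $d$. $T(p)(n)=\max\{p(n)-1,0\}$. For a block sequence $A=(p_n)$, $[A]$ is the set of $T^{(i_0)}(p_{n_0})+\dots+T^{(i_l)}(p_{n_l})$ with $n_0<\dots<n_l$, $i_j\in\{0,\dots,k\}$, some $i_j=0$. $X\le Y$: every element of $X$ in $[Y]$. $r_n(A)$: first $n$ elements; $[a,A]=\{B:\exists n\ r_n(B)=a,\ B\le A\}$; $[n,A]=[r_n(A),A]$; $r_n[a,A]=\{r_n(B):B\in[a,A]\}$; $\mathrm{FIN}_k^{<\infty}\upharpoonright A=\{a:[a,A]\ne\emptyset\}$; $\mathrm{depth}_A(a)=\min\{n:a\le r_n(A)\}$; $\mathcal H\upharpoonright A=\{B\in\mathcal H:B\le A\}$. A coideal is $\mathcal H\subseteq\mathrm{FIN}_k^\infty$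 such that: (a) $A\in\mathcal H$ and $A\triangle B$ finite imply $B\in\mathcal H$; (b) $A\in\mathcal H$, $A\le B$ imply $B\in\mathcal H$; (c) for $A\in\mathcal H$, $a\in\mathrm{FIN}_k^{<\infty}\upharpoonright A$: $[a,B]\ne\emptyset$ for all $B\in[\mathrm{depth}_A(a),A]\cap\mathcal H$, and if $B\in\mathcal H\upharpoonright A$, $[a,B]\ne\emptyset$, then some $A'\in[\mathrm{depth}_A(a),A]\cap\mathcal H$ has $\emptyset\ne[a,A']\subseteq[a,B]$; (d) for $A\in\mathcal H$, $a\in\mathrm{FIN}_k^{<\infty}\upharpoonright A$, $\mathcal O\subseteq\mathrm{FIN}_k^{[|a|+1]}$, some $B\in[\mathrm{depth}_A(a),A]\cap\mathcal H$ has $r_{|a|+1}[a,B]\subseteq\mathcal O$ or disjoint from $\mathcal O$. $\mathcal D\subseteq\mathcal S\subseteq\mathcal H$ is dense open in $\mathcal S$ if every $A\in\mathcal S$ has $B\in\mathcal D$, $B\le A$, and $A\in\mathcal S$, $B\in\mathcal D$, $A\le B$ imply $A\in\mathcal D$. $\mathcal H$ is semiselective if for every $A\in\mathcal H$, every family $(\mathcal D_a)_{a\in\mathrm{FIN}_k^{<\infty}\upharpoonright A}$ with $\mathcal D_a$ dense open in $\mathcal H\cap[\mathrm{depth}_A(a),A]$, and every $C\in\mathcal H\upharpoonright A$, there are $B\in\mathcal H\upharpoonright C$ and $A_a\in\mathcal D_a$ with $[a,B]\subseteq[a,A_a]$ for all $a\in\mathrm{FIN}_k^{<\infty}\upharpoonright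 B$. $\mathbb M_{\mathcal H}=\{(s,A)\in\mathrm{FIN}_k^{<\infty}\times\mathcal H: s<A\}$ (every block of $s$ below every block of $A$), ordered by $(s,A)\le(t,B)$ iff $t$ is an initial segment of $s$, $A\le B$, and every block of $s$ not in $t$ belongs to $[B]$. *)

(* Defs.v *)
From mathcomp Require Import all_boot all_classical.

Set Implicit Arguments.
Unset Strict Implicit.
Unset Printing Implicit Defensive.

Local Open Scope classical_set_scope.

(** ** Block sequences *)

(* Finite block sequences are [seq block], infinite ones [nat -> block];
   [FIN], [FINfin] and [FINinf] cut out the actual members. *)
Definition block := nat -> nat.

Definition supp (p : block) : set nat := [set n | p n <> 0].

Definition FIN (k : nat) : set block :=
  [set p | [/\ forall n, p n <= k, finite_set (supp p) & exists n, p n = k]].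

(* For nonempty finite supports this says max supp(p) < min supp(q). *)
Definition block_lt (p q : block) : Prop :=
  forall m n, supp p m -> supp q n -> m < n.

Definition zero_block : block := fun=> 0.

Definition FINinf (k : nat) : set (nat -> block) :=
  [set A | (forall n, FIN k (A n)) /\ (forall n, block_lt (A n) (A n.+1))].

Definition FINfin (k : nat) : set (seq block) :=
  [set a | (forall p, p \in a -> FIN k p) /\
           (forall i, i.+1 < size a ->
              block_lt (nth zero_block a i) (nth zero_block a i.+1))].

Definition FINlen (k d : nat) : set (seq block) :=
  FINfin k `&` [set a | size a = d].

Definition T (p : block) : block := fun n => (p n).-1.

(* The list [w] holds the pairs (n_j, i_j). It is nonempty because some i_j
   is 0. *)
Definition combinations (k : nat) (D : set nat) (A : nat -> block) : set block :=
  [set q | exists w : seq (nat * nat),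
     [/\ sorted ltn (map fst w),
         forall x, x \in w -> D x.1 /\ x.2 <= k,
         exists2 x, x \in w & x.2 = 0
       & q = (fun m => \sum_(x <- w) iter x.2 T (A x.1) m)]].

(* [A], for A infinite and for A finite. *)
Definition span (k : nat) (A : nat -> block) : set block :=
  combinations k setT A.
Definition span_seq (k : nat) (a : seq block) : set block :=
  combinations k [set n | n < size a] (nth zero_block a).

(* X <= Y, for X, Y both infinite and for X, Y both finite. *)
Definition below (k : nat) (B A : nat -> block) : Prop :=
  range B `<=` span k A.
Definition below_seq (k : nat) (b a : seq block) : Prop :=
  [set` b] `<=` span_seq k a.

(* r_n(A) *)
Definition rn (n : nat) (A : nat -> block) : seq block := mkseq A n.

(* [a, A] *)
Definition basic (k : nat) (a : seq block) (A : nat -> block) :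
    set (nat -> block) :=
  [set B | [/\ FINinf k B, exists n, rn n B = a & below k B A]].

(* [n, A] *)
Definition basicn (k n : nat) (A : nat -> block) : set (nat -> block) :=
  basic k (rn n A) A.

(* FIN_k^{<oo} restricted to A *)
Definition FINfin_below (k : nat) (A : nat -> block) : set (seq block) :=
  FINfin k `&` [set a | basic k a A !=set0].

(* The minimum of {n : a <= r_n(A)}; the junk value 0 is taken when this set
   is empty, which does not happen for a in [FINfin_below k A]. *)
Definition depth (k : nat) (A : nat -> block) (a : seq block) : nat :=
  xget 0 [set n | below_seq k a (rn n A) /\
                  forall m, below_seq k a (rn m A) -> n <= m].

(** ** Coideals *)

Definition fam_below (k : nat) (H : set (nat -> block)) (A : nat -> block) :
    set (nat -> block) :=
  H `&` [set B | below k B A].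

Definition symdiff (X Y : set block) : set block := (X `\` Y) `|` (Y `\` X).

Record coideal (k : nat) (H : set (nat -> block)) : Prop := Coideal {
  coideal_sub : H `<=` FINinf k;
  coideal_finite : forall A B, H A -> FINinf k B ->
    finite_set (symdiff (range A) (range B)) -> H B;
  coideal_up : forall A B, H A -> FINinf k B -> below k A B -> H B;
  coideal_amalg1 : forall A a, H A -> FINfin_below k A a ->
    forall B, (basicn k (depth k A a) A `&` H) B -> basic k a B !=set0;
  coideal_amalg2 : forall A a, H A -> FINfin_below k A a ->
    forall B, fam_below k H A B -> basic k a B !=set0 ->
    exists A', [/\ (basicn k (depth k A a) A `&` H) A',
                   basic k a A' !=set0 & basic k a A' `<=` basic k a B];
  coideal_pigeon : forall A a (O : set (seq block)),
    H A -> FINfin_below k A a -> O `<=` FINlen k (size a).+1 ->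
    exists2 B, (basicn k (depth k A a) A `&` H) B &
      rn (size a).+1 @` basic k a B `<=` O \/
      rn (size a).+1 @` basic k a B `&` O = set0
}.

Definition dense_open (k : nat) (S D : set (nat -> block)) : Prop :=
  [/\ D `<=` S,
      forall A, S A -> exists2 B, D B & below k B A
    & forall A B, S A -> D B -> below k A B -> D A].

Definition semiselective (k : nat) (H : set (nat -> block)) : Prop :=
  forall A, H A ->
  forall D : seq block -> set (nat -> block),
    (forall a, FINfin_below k A a ->
       dense_open k (H `&` basicn k (depth k A a) A) (D a)) ->
  forall C, fam_below k H A C ->
  exists2 B, fam_below k H C B &
    forall a, FINfin_below k B a ->
      exists2 Aa, D a Aa & basic k a B `<=` basic k a Aa.

(** ** The forcing language of a preorder *)

(* The names of the forcing language, in the style of Aczel's sets: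
   [Name c x] is the name {(x i, c i) : i in X}. *)
Inductive name (P : Type) : Type :=
  Name (X : Type) (c : X -> P) (x : X -> name P).

(* First-order formulas in = and \in with at most n free variables and names
   as parameters. Variables are de Bruijn indices: [All] binds [ord0]. The
   other connectives are the usual classical abbreviations. *)
Inductive term (P : Type) (n : nat) : Type :=
  | Var of 'I_n
  | Cst of name P.

Inductive formula (P : Type) : nat -> Type :=
  | FMem n of term P n & term P n : formula P n
  | FEq n of term P n & term P n : formula P n
  | FNot n of formula P n : formula P n
  | FAnd n of formula P n & formula P n : formula P n
  | FAll n of formula P n.+1 : formula P n.

Definition sentence (P : Type) : Type := formula P 0.

(* Throughout, [le p q] reads "p is stronger than q" (or equal).
   p ||- x = y iff every q <= p below the condition attached to a member of
   one of x, y forces that member to belong to the other one; the membership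
   is unfolded as in [force_mem] below, so that the recursion is structural. *)
Fixpoint force_eq (P : Type) (le : P -> P -> Prop) (x y : name P) (p : P) :
    Prop :=
  match x, y with
  | @Name _ X c u, @Name _ Y d v =>
      (forall i q, le q p -> le q (c i) ->
         forall r, le r q -> exists s, le s r /\
           exists j, le s (d j) /\ force_eq le (u i) (v j) s) /\
      (forall j q, le q p -> le q (d j) ->
         forall r, le r q -> exists s, le s r /\
           exists i, le s (c i) /\ force_eq le (u i) (v j) s)
  end.

Definition force_mem (P : Type) (le : P -> P -> Prop) (x y : name P) (p : P) :
    Prop :=
  match y with
  | @Name _ Y d v =>
      forall r, le r p -> exists s, le s r /\
        exists j, le s (d j) /\ force_eq le x (v j) s
  end.

Definition eval (P : Type) (n : nat) (e : 'I_n -> name P) (t : term P n) :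
    name P :=
  match t with Var i => e i | Cst x => x end.

Definition extend (P : Type) (n : nat) (x : name P) (e : 'I_n -> name P) :
    'I_n.+1 -> name P :=
  fun i => if unlift ord0 i is Some j then e j else x.

Fixpoint forces_in (P : Type) (le : P -> P -> Prop) (n : nat)
    (f : formula P n) : ('I_n -> name P) -> P -> Prop :=
  match f in formula _ m return ('I_m -> name P) -> P -> Prop with
  | FMem _ t u => fun e p => force_mem le (eval e t) (eval e u) p
  | FEq _ t u => fun e p => force_eq le (eval e t) (eval e u) p
  | FNot _ g => fun e p => forall q, le q p -> ~ forces_in le g e q
  | FAnd _ g h => fun e p => forces_in le g e p /\ forces_in le h e p
  | FAll _ g => fun e p => forall x, forces_in le g (extend x e) p
  end.

Definition empty_env (P : Type) : 'I_0 -> name P :=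
  fun i => False_rect (name P) (notF (ltn_ord i)).

Definition forces (P : Type) (le : P -> P -> Prop) (p : P) (f : sentence P) :
    Prop :=
  forces_in le f (@empty_env P) p.

Definition decides (P : Type) (le : P -> P -> Prop) (p : P) (f : sentence P) :
    Prop :=
  forces le p f \/ forces le p (FNot f).

(** ** The forcing notion M_H *)

Record condition (k : nat) (H : set (nat -> block)) : Type := Condition {
  stem : seq block;
  tail : nat -> block;
  stem_fin : FINfin k stem;
  tail_in : H tail;
  stem_lt_tail : forall p n, p \in stem -> block_lt p (tail n)
}.

Definition condition_le (k : nat) (H : set (nat -> block))
    (c d : condition k H) : Prop :=
  [/\ prefix (stem d) (stem c),
      below k (tail c) (tail d)
    & forall p, p \in stem c -> p \notin stem d -> span k (tail d) p].

Definition pure_decision (k : nat) (H : set (nat -> block)) : Prop :=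
  forall (f : sentence (condition k H)) (c : condition k H),
    exists d : condition k H,
      [/\ stem d = stem c, below k (tail d) (tail c)
        & decides (@condition_le k H) d f].

(* Main.v *)
(* Write s for the stem of the given condition. The conditions deciding the
   sentence form the union of two open sets [U true] and [U false] that are
   regular (contain each condition below which they are dense), and this union
   is dense. A first application of semiselectivity gives [B1] such that, for
   each [b] below [B1], if some condition with stem [s ++ b] and tail below [B1]
   decides, then all of them decide, in the same way. By (d) and a second
   application of semiselectivity there is [B2] below [B1] such that, for each
   [a] below [B2], whether all the conditions with stem [s ++ rcons a y] and
   tail below [B1] lie in [U e] does not depend on [y]. If the decision is made
   with stem [s ++ rcons a y] for one [y], it is hence made for all [y], and by
   regularity already with stem [s ++ a]. Removing the blocks of a deciding
   extension one by one leads back to the stem s. *)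

Require Import Defs.
From mathcomp Require Import all_boot all_classical.
From mathcomp Require Import zify.

Set Implicit Arguments.
Unset Strict Implicit.
Unset Printing Implicit Defensive.

Local Open Scope classical_set_scope.

(** * The forcing relation: monotonicity and density *)

Section Forcing.
Variables (P : Type) (le : P -> P -> Prop).
Hypothesis le_refl : forall p, le p p.
Hypothesis le_trans : forall p q r, le p q -> le q r -> le p r.

Lemma force_eq_le x y p q : le q p -> force_eq le x y p -> force_eq le x y q.
Proof.
case: x => X c u; case: y => Y d v qp /= [h1 h2].
by split=> i r rq; [apply: h1|apply: h2]; apply: le_trans rq qp.
Qed.

(** Each clause for equality already asks for some [s] below every [r], so one can first pass from
    [r] to a [t] forcing the equality and use its clause at [t]. *)
Lemma force_eq_dense x y p :
  (forall q, le q p -> exists2 r, le r q & force_eq le x y r) ->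
  force_eq le x y p.
Proof.
case: x => X c u; case: y => Y d v /= h.
split=> i q qp qi r rq; have [t tr [h1 h2]] := h _ (le_trans rq qp).
- have [|s [st hs]] := h1 i t (le_refl t) _ t (le_refl t).
    exact: le_trans tr (le_trans rq qi).
  by exists s; split=> //; apply: le_trans st tr.
- have [|s [st hs]] := h2 i t (le_refl t) _ t (le_refl t).
    exact: le_trans tr (le_trans rq qi).
  by exists s; split=> //; apply: le_trans st tr.
Qed.

Lemma force_mem_le x y p q :
  le q p -> force_mem le x y p -> force_mem le x y q.
Proof. by case: y => Y d v qp /= h r rq; apply: h (le_trans rq qp). Qed.

Lemma force_mem_dense x y p :
  (forall q, le q p -> exists2 r, le r q & force_mem le x y r) ->
  force_mem le x y p.
Proof.
case: y => Y d v /= h r rp; have [t tr /(_ t (le_refl t))[s [st hs]]] := h r rp.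
by exists s; split=> //; apply: le_trans st tr.
Qed.

Lemma forces_in_le n (f : formula P n) e p q :
  le q p -> forces_in le f e p -> forces_in le f e q.
Proof.
move=> qp; elim: f e => {n} [n t u|n t u|n g _|n g IHg h IHh|n g IHg] e /=.
- exact: force_mem_le.
- exact: force_eq_le.
- by move=> np r rq; apply: np (le_trans rq qp).
- by case=> /IHg ? /IHh.
- by move=> hp x; apply: IHg.
Qed.

(** For a negation, an extension forcing [g] would have a further extension forcing both [g] and its
    negation. This yields the regularity of the set of conditions forcing a sentence. *)
Lemma forces_in_dense n (f : formula P n) e p :
  (forall q, le q p -> exists2 r, le r q & forces_in le f e r) ->
  forces_in le f e p.
Proof.
elim: f e => {n} [n t u|n t u|n g _|n g IHg h IHh|n g IHg] e /= hp.
- exact: force_mem_dense.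
- exact: force_eq_dense.
- move=> q qp gq; have [r rq /(_ r (le_refl r))] := hp q qp.
  by apply; apply: forces_in_le gq.
- by split; [apply: IHg|apply: IHh] => q /hp[r rq []]; exists r.
- by move=> x; apply: IHg => q /hp[r rq /(_ x)]; exists r.
Qed.

Lemma decides_dense (f : sentence P) p : exists2 q, le q p & decides le q f.
Proof.
have [[q qp fq]|nf] := pselect (exists2 q, le q p & forces le q f).
  by exists q => //; left.
by exists p => //; right => q qp fq; apply: nf; exists q.
Qed.

End Forcing.

(** * Combinations of blocks described by exponents *)

Lemma iter_T i (p : block) m : iter i T p m = p m - i.
Proof. by elim: i => [|i IHi] /=; rewrite ?subn0 // /T IHi subnS. Qed.

(* When the [A n] have pairwise disjoint supports, an element of [span k A] is
   given by an exponent [f n] for each index [n]; exponent [k] makes the term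
   vanish, so that no list of indices is needed. *)
Definition exponents (k : nat) (D : set nat) (A : nat -> block) (q : block)
    (f : nat -> nat) : Prop :=
  [/\ forall n, f n <= k /\ (f n < k -> D n),
      exists N, forall n, N <= n -> f n = k,
      exists n, f n = 0,
      forall n m, A n m != 0 -> q m = A n m - f n
    & forall m, (forall n, A n m = 0) -> q m = 0].

(** At each point at most one [A n] is nonzero, so the sum reduces there to at most one term
    [A n m - f n]. *)
Lemma combinationsP k (D : set nat) A q : 0 < k -> (forall n m, A n m <= k) ->
  (forall n n' m, A n m != 0 -> A n' m != 0 -> n = n') ->
  combinations k D A q <-> exists f, exponents k D A q f.
Proof.
move=> k0 Ak disj; split.
- case=> w [ws wD [x0 x0w x00] ->].
  have uw : uniq (map fst w).
    by apply: sorted_uniq ws => //; [exact: ltn_trans|exact: ltnn].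
  have inj x y : x \in w -> y \in w -> x.1 = y.1 -> x = y.
    move=> xw yw exy; rewrite -(nth_index x xw) -(nth_index x yw).
    congr nth; apply/eqP; rewrite -(nth_uniq 0 _ _ uw) ?size_map ?index_mem //.
    by rewrite !(nth_map x) ?index_mem // !nth_index // exy.
  (* Indices missing from [w] get the default exponent [k], which kills a block with values at most
     [k]. *)
  pose f (n : nat) : nat := xget k [set i | (n, i) \in w].
  have fw x : x \in w -> f x.1 = x.2.
    move=> xw; have : [set i | (x.1, i) \in w] (f x.1).
      by apply: (@xgetPex _ k); exists x.2; rewrite /= -surjective_pairing.
    by move=> /= h; have := inj _ _ h xw erefl => <-.
  have fk n : n \notin map fst w -> f n = k.
    by rewrite /f; case: xgetP => // i _ /= iw /negP[]; apply/mapP; exists (n, i).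
  exists f; split.
  + move=> n; have [/mapP[x xw ->]|/fk ->] := boolP (n \in map fst w).
      by rewrite fw //; have [] := wD _ xw.
    by rewrite leqnn ltnn.
  + exists (\max_(n <- map fst w) n).+1 => n ln; apply: fk; apply/negP => nw.
    by have := leq_trans ln (@leq_bigmax_seq _ _ xpredT id n nw isT); rewrite ltnn.
  + by exists x0.1; rewrite fw.
  + move=> n m Anm; have [/mapP[x xw en]|nw] := boolP (n \in map fst w).
      rewrite (bigD1_seq x) ?(map_uniq uw) //= big_seq_cond big1 ?addn0 ?iter_T.
        by rewrite en fw.
      move=> y /andP[yw nyx]; rewrite iter_T; have [->//|Ay] := eqVneq (A y.1 m) 0.
      by case/eqP: nyx; apply: inj => //; rewrite -en; apply: disj Ay Anm.
    rewrite fk // big_seq big1 => [|y yw]; first by have := Ak n m; lia.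
    rewrite iter_T; have [->//|Ay] := eqVneq (A y.1 m) 0.
    by case/negP: nw; apply/mapP; exists y => //; apply: disj Anm Ay.
  + by move=> m A0; rewrite big1 // => x _; rewrite iter_T A0.
- case=> f [fD [N fN] [n0 fn0] fA f0].
  (* [N] bounds the indices whose terms survive; [n0.+1] puts the index with exponent 0 into the
     list. *)
  pose M := maxn N n0.+1.
  have fM n : M <= n -> f n = k by rewrite /M geq_max => /andP[/fN].
  exists [seq (n, f n) | n <- iota 0 M & f n < k]; split.
  + rewrite -map_comp map_id_in //; apply: sorted_filter; first exact: ltn_trans.
    exact: iota_ltn_sorted.
  + move=> x /mapP[n]; rewrite mem_filter => /andP[fnk _] -> /=.
    by have [h /(_ fnk)] := fD n.
  + exists (n0, f n0) => //; apply/mapP; exists n0 => //.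
    by rewrite mem_filter mem_iota fn0 k0 /M /=; lia.
  + apply/funext => m; rewrite big_map big_filter.
    have [[n Anm]|nA] := pselect (exists n, A n m != 0); last first.
      have A0 n : A n m = 0 by apply/eqP; apply: contra_notT nA => ?; exists n.
      by rewrite f0 // big1 // => n _; rewrite iter_T A0.
    have z i : i != n -> A i m = 0.
      move=> ni; have [//|h] := eqVneq (A i m) 0.
      by rewrite (disj _ _ _ h Anm) eqxx in ni.
    rewrite (fA _ _ Anm) big_mkcond /=.
    have [nM|/fM fnk] := ltnP n M.
      rewrite (bigD1_seq n) ?mem_iota ?iota_uniq //= big1 => [|i ni].
        by case: ltnP; rewrite ?iter_T /= ?addn0 //; have := Ak n m; lia.
      by rewrite iter_T z //; case: ifP.
    rewrite big1 => [|i _]; first by have := Ak n m; lia.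
    have [->|ni] := eqVneq i n; first by rewrite fnk ltnn.
    by rewrite iter_T z //; case: ifP.
Qed.

(** * Infinite block sequences and the order [below] *)

Section Blocks.
Variable k : nat.
Hypothesis k_gt0 : 0 < k.

Lemma FIN_neq0 p : FIN k p -> exists m, supp p m.
Proof. by case=> _ _ [m pm]; exists m; rewrite /supp /= pm; lia. Qed.

Lemma FINinf_peak A n : FINinf k A -> exists m, A n m = k.
Proof. by case=> /(_ n)[]. Qed.

Lemma FINinf_le A n m : FINinf k A -> A n m <= k.
Proof. by case=> /(_ n)[]. Qed.

Lemma FINinf_lt A i j : FINinf k A -> i < j -> block_lt (A i) (A j).
Proof.
case=> AF Alt; elim: j => // j IHj; rewrite ltnS leq_eqVlt => /orP[/eqP->|/IHj h].
  exact: Alt.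
move=> m n im jn; have [x jx] := FIN_neq0 (AF j).
exact: ltn_trans (h _ _ im jx) (Alt _ _ _ jx jn).
Qed.

Lemma FINinf_disj A n n' m : FINinf k A -> A n m != 0 -> A n' m != 0 -> n = n'.
Proof.
move=> AF /eqP h /eqP h'.
by case: (ltngtP n n') => // /(FINinf_lt AF); [move=> /(_ _ _ h h')|move=> /(_ _ _ h' h)];
  rewrite ltnn.
Qed.

Lemma exponentsP D A q : FINinf k A ->
  combinations k D A q <-> exists f, exponents k D A q f.
Proof.
move=> AF; apply: combinationsP => // [n m|n n' m]; first exact: FINinf_le.
exact: FINinf_disj.
Qed.

Lemma span_self A n : span k A (A n).
Proof.
exists [:: (n, 0)]; split=> //; first by move=> x; rewrite inE => /eqP->.
  by exists (n, 0); rewrite ?inE.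
by apply/funext => m; rewrite big_seq1.
Qed.

Lemma below_refl A : below k A A.
Proof. by move=> _ [n _ <-]; apply: span_self. Qed.

Lemma span_trans A B q : FINinf k A -> FINinf k B -> below k A B ->
  span k A q -> span k B q.
Proof.
move=> AF BF AB /(exponentsP _ _ AF)[f [fk [N fN] [n0 fn0] fA f0]].
have /choice[g gP] n : exists g, exponents k setT B (A n) g.
  by apply/(exponentsP _ _ BF); apply: AB; exists n.
(* Every [A n] using [B m] is nonzero at a peak of [B m]. The supports of the [A n] are disjoint, so
   at most one of them uses [B m]. *)
have uniq_g m n n' : g n m < k -> g n' m < k -> n = n'.
  have [y By] := FINinf_peak m BF => h h'.
  have [_ _ _ /(_ m y) e _] := gP n; have [_ _ _ /(_ m y) e' _] := gP n'.
  by apply: (FINinf_disj (m := y) AF); rewrite (e, e') By; lia.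
apply/(exponentsP _ _ BF).
(* Iterates of [T] compose by adding exponents; the sum is capped at [k], where the term has
   vanished anyway. *)
have /choice[h hc] m : exists i,
    (exists2 n, g n m < k & i = minn k (g n m + f n)) \/
    (forall n, k <= g n m) /\ i = k.
  have [[n gn]|ng] := pselect (exists n, g n m < k).
    by exists (minn k (g n m + f n)); left; exists n.
  exists k; right; split=> // n; rewrite leqNgt; apply/negP => gn.
  by apply: ng; exists n.
exists h; split.
- by move=> m; split=> //; case: (hc m) => [[n _ ->]|[_ ->]] //; rewrite geq_minl.
(* Only the [A n] with [n < N] contribute to [q], and each of them uses finitely many [B m]. *)
- have /choice[M MP] n : exists M, forall m, M <= m -> g n m = k by case: (gP n).
  exists (\max_(i < N) M i) => m lm; case: (hc m) => [[n gn ->]|[_ ->]] //.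
  have [nN|/fN ->] := ltnP n N; last by lia.
  have := leq_trans (leq_bigmax (F := fun i : 'I_N => M i) (Ordinal nN)) lm.
  by move=> /MP /= e; rewrite e ltnn in gn.
- have [_ _ [m gm] _ _] := gP n0; exists m.
  case: (hc m) => [[n gn ->]|[/(_ n0)]]; last by rewrite gm leqNgt k_gt0.
  have <- : n0 = n by apply: uniq_g gn; rewrite gm.
  by rewrite gm fn0 minn0.
- move=> m x Bmx; have Bk := FINinf_le m x BF.
  have Ae n : A n x = B m x - g n m by have [_ _ _ e _] := gP n; apply: e.
  case: (hc m) => [[n gn ->]|[gm ->]].
    have [Anx|Anx] := eqVneq (A n x) 0; last by rewrite (fA _ _ Anx) Ae; lia.
    rewrite f0; first by have := Ae n; lia.
    move=> n'; have [->//|nn] := eqVneq n' n; rewrite Ae.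
    have [/uniq_g -/(_ _ gn) e|] := ltnP (g n' m) k; first by rewrite e eqxx in nn.
    by lia.
  rewrite f0; first by lia.
  by move=> n; rewrite Ae; have := gm n; lia.
- move=> x Bx; apply: f0 => n; have [_ _ _ _ e] := gP n; exact: e.
Qed.

Lemma below_trans A B C : FINinf k A -> FINinf k B -> FINinf k C ->
  below k A B -> below k B C -> below k A C.
Proof. by move=> AF BF CF AB BC q /AB; apply: span_trans. Qed.

Lemma basic_sub A B a : FINinf k A -> FINinf k B -> below k A B ->
  basic k a A `<=` basic k a B.
Proof. by move=> AF BF AB C [CF ra CA]; split=> //; apply: below_trans AB. Qed.


(** * Prolonging a finite block sequence by an infinite one *)

Definition icat (a : seq block) (E : nat -> block) : nat -> block :=
  fun n => if n < size a then nth zero_block a n else E (n - size a).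

Lemma icat_nth a E n : n < size a -> icat a E n = nth zero_block a n.
Proof. by rewrite /icat => ->. Qed.

Lemma icat_shift a E n : icat a E (size a + n) = E n.
Proof. by rewrite /icat ltnNge leq_addr addKn. Qed.

Lemma icatA a b E : icat (a ++ b) E = icat a (icat b E).
Proof.
apply/funext => n; rewrite /icat size_cat nth_cat.
case: (ltnP n (size a)) => [na|an]; first by rewrite ltn_addr.
by rewrite ltn_subLR // subnDA.
Qed.

Lemma rn_icat a E : rn (size a) (icat a E) = a.
Proof.
apply: (@eq_from_nth _ zero_block); rewrite size_mkseq // => i ia.
by rewrite nth_mkseq // icat_nth.
Qed.

Lemma icat_rn d A : icat (rn d A) (fun n => A (d + n)) = A.
Proof.
apply/funext => n; rewrite /icat size_mkseq.
by case: ltnP => h; rewrite ?nth_mkseq // subnKC.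
Qed.

(** With [E] in [H], the right-hand side is what makes [a] and [E] a condition. Blocks can thus be
    moved between stem and tail by regrouping with [icatA]. *)
Lemma FINinf_icat a E : FINinf k (icat a E) <->
  [/\ FINfin k a, FINinf k E & forall p n, p \in a -> block_lt p (E n)].
Proof.
split=> [aE|[[aF alt] [EF Elt] aE]].
- have [F lt] := aE; split.
  + split=> [p /(nthP zero_block)[i ia <-]|i ia]; first by rewrite -(icat_nth E ia).
    by rewrite -(icat_nth E ia) -(icat_nth E (ltnW ia)).
  + split=> n; first by rewrite -(icat_shift a).
    by rewrite -(icat_shift a E n) -(icat_shift a E n.+1) addnS.
  + move=> _ n /(nthP zero_block)[i ia <-]; rewrite -(icat_nth E ia) -(icat_shift a E n).
    by apply: FINinf_lt => //; apply: ltn_addr.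
- split=> n; rewrite /icat.
    by case: ltnP => [na|_] //; apply: aF; apply: mem_nth.
  case: (ltnP n.+1 (size a)) => [na|na]; first by rewrite (ltnW na); apply: alt.
  by case: ltnP => na'; [apply: aE; apply: mem_nth|rewrite subSn].
Qed.

Lemma below_icat a E X : below k (icat a E) X <->
  (forall p, p \in a -> span k X p) /\ below k E X.
Proof.
split=> [aE|[aX EX] _ [n _ <-]]; last first.
  rewrite /icat; case: ltnP => h; first by apply: aX; apply: mem_nth.
  by apply: EX; exists (n - size a).
split=> [_ /(nthP zero_block)[i ia <-]|_ [n _ <-]]; apply: aE.
  by exists i => //; rewrite icat_nth.
by exists (size a + n) => //; rewrite icat_shift.
Qed.

Lemma below_icatr a E : below k E (icat a E).
Proof. by move=> _ [n _ <-]; rewrite -(icat_shift a E); apply: span_self. Qed.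

Lemma basic_icat a E A : FINinf k (icat a E) ->
  (forall p, p \in a -> span k A p) -> below k E A -> basic k a A (icat a E).
Proof.
by move=> aE aA EA; split=> //; [exists (size a); apply: rn_icat|apply/below_icat].
Qed.

Lemma FINfin_below_icat a E A : FINinf k (icat a E) ->
  (forall p, p \in a -> span k A p) -> below k E A -> FINfin_below k A a.
Proof.
move=> aE aA EA; split; first by have [] := (FINinf_icat _ _).1 aE.
by exists (icat a E); apply: basic_icat.
Qed.

Lemma FINfin_below_span A a p : FINfin_below k A a -> p \in a -> span k A p.
Proof.
case=> _ [B [_ [n <-] BA]] /(nthP zero_block)[i]; rewrite size_mkseq => ni <-.
by rewrite nth_mkseq //; apply: BA; exists i.
Qed.

(** * The depth of a finite block sequence *)

Lemma span_rnP n A p : FINinf k A ->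
  span_seq k (rn n A) p <-> exists f, exponents k [set i | i < n] A p f.
Proof.
move=> AF; have -> : span_seq k (rn n A) = combinations k [set i | i < n] A.
  rewrite /span_seq /combinations size_mkseq; apply/funext => q; apply/propext.
  have e w : (forall x, x \in w -> x.1 < n /\ x.2 <= k) ->
      (fun m => \sum_(x <- w) iter x.2 T (nth zero_block (rn n A) x.1) m) =
      (fun m => \sum_(x <- w) iter x.2 T (A x.1) m).
    move=> wn; apply/funext => m; apply: eq_big_seq => x /wn[xn _].
    by rewrite nth_mkseq.
  by split=> -[w [ws wn w0 ->]]; exists w; split=> //; rewrite (e w).
exact: exponentsP.
Qed.

Lemma below_rn A a : FINinf k A -> FINfin_below k A a ->
  exists n, below_seq k a (rn n A).
Proof.
move=> AF /FINfin_below_span aA; elim: a aA => [|p a IHa] aA.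
  by exists 0 => p; rewrite /= in_nil.
have [|n an] := IHa; first by move=> q qa; apply: aA; rewrite inE qa orbT.
have [f [fD [N fN] f0 f1 f2]] : exists f, exponents k setT A p f.
  by apply/(exponentsP _ _ AF); apply: aA; rewrite inE eqxx.
exists (maxn N n) => q; rewrite /= inE => /orP[/eqP->|/an].
  apply/(span_rnP _ _ AF); exists f; split=> //; last by exists N.
  move=> i; split=> [|fi /=]; first by have [] := fD i.
  rewrite leq_max; apply/orP; left; rewrite ltnNge; apply/negP => /fN e.
  by rewrite e ltnn in fi.
move=> /(span_rnP _ _ AF)[g [gD gN g0 g1 g2]].
apply/(span_rnP _ _ AF); exists g; split=> // i; have [gk gn] := gD i.
by split=> // /gn /=; lia.
Qed.

Lemma depthP A a : FINinf k A -> FINfin_below k A a ->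
  below_seq k a (rn (depth k A a) A) /\
  forall m, below_seq k a (rn m A) -> depth k A a <= m.
Proof.
move=> AF aA; have [n an] := below_rn AF aA.
apply: (@xgetPex nat 0 [set n | below_seq k a (rn n A) /\
  forall m, below_seq k a (rn m A) -> n <= m]).
have ex : exists n, `[< below_seq k a (rn n A) >].
  by exists n; apply/asboolP.
exists (ex_minn ex); case: ex_minnP => m /asboolP am mmin; split=> // i ai.
by apply: mmin; apply/asboolP.
Qed.

(** Whether [a] is below the first n blocks depends on these blocks only. The lemma serves to see
    that applying (d) inside a member of $[\mathrm{depth}_A(a),A]$ does not leave this set. *)
Lemma depth_rn A B a : FINinf k A -> FINinf k B ->
  FINfin_below k A a -> FINfin_below k B a ->
  rn (depth k A a) B = rn (depth k A a) A -> depth k B a = depth k A a.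
Proof.
move=> AF BF aA aB e; have [A1 A2] := depthP AF aA; have [B1 B2] := depthP BF aB.
have le : depth k B a <= depth k A a by apply: B2; rewrite e.
apply/eqP; rewrite eqn_leq le; apply: A2.
have er m : m <= depth k A a -> rn m B = rn m A.
  move=> h; apply: (@eq_from_nth _ zero_block); rewrite ?size_mkseq // => i im.
  have ih := leq_trans im h.
  by rewrite !nth_mkseq // -(nth_mkseq zero_block B ih) -/(rn _ _) e nth_mkseq.
by rewrite -(er _ le).
Qed.

(* The last block of [A] needed for [a] may extend beyond [a], but each nonzero
   [T]-iterate of it meets a block of [a]. *)
Lemma exponents_above_depth A B a q f j : FINinf k A -> FINinf k B ->
  FINfin_below k A a -> rn (depth k A a) B = rn (depth k A a) A ->
  (forall p, p \in a -> block_lt p q) -> exponents k setT B q f ->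
  j < depth k A a -> f j = k.
Proof.
move=> AF BF aA e aq [fD fN _ f1 _] jd; have [A1 A2] := depthP AF aA.
set d := depth k A a in e jd A1 A2.
have BA i : i < d -> B i = A i.
  by move=> id; rewrite -(nth_mkseq zero_block B id) -/(rn _ _) e nth_mkseq.
have d0 : d.-1 < d by lia.
(* If all blocks of [a] vanished at the peaks of [A d.-1], they would have exponent [k] there, and
   [a] would be below the first [d.-1] blocks, against the minimality of the depth. *)
have [p pa [y Ay py]] : exists2 p, p \in a & exists2 y, A d.-1 y = k & p y != 0.
  apply: contrapT => na; have : d <= d.-1; last by lia.
  apply: A2 => p pa; have /(span_rnP _ _ AF)[g [gD gN g0 g1 g2]] := A1 _ pa.
  apply/(span_rnP _ _ AF); exists g; split=> // i; have [gk gd] := gD i.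
  split=> // gi; have := gd gi; rewrite /= => id; suff: i != d.-1 by lia.
  apply/eqP => ei; apply: na; exists p => //.
  have [y Ay] := FINinf_peak d.-1 AF; exists y => //.
  by rewrite (g1 d.-1) Ay -?ei; lia.
(* Since [q] lies past [y], it vanishes at this peak [x] of [A j], which forces the exponent [k]. *)
have [x Ax xy] : exists2 x, A j x = k & x <= y.
  have [jd1|->] : j < d.-1 \/ j = d.-1 by lia.
    have [x Ax] := FINinf_peak j AF; exists x => //; apply: ltnW.
    by apply: (FINinf_lt AF jd1); rewrite /supp /= ?Ax ?Ay; lia.
  by exists y.
have qx : q x = 0.
  apply/eqP; apply: contraTT xy => /eqP qx; rewrite -ltnNge.
  by apply: aq pa _ _ _ qx; apply/eqP.
have := f1 j x; rewrite BA // Ax qx; have [fk _] := fD j; lia.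
Qed.


(** By [exponents_above_depth] the first [d] exponents of [q] equal [k]; the others, shifted by [d],
    describe [q] over [E]. *)
Lemma span_above_depth A a E q : FINinf k A -> FINfin_below k A a ->
  FINinf k (icat (rn (depth k A a) A) E) ->
  (forall p, p \in a -> block_lt p q) ->
  span k (icat (rn (depth k A a) A) E) q -> span k E q.
Proof.
set d := depth k A a => AF aA BF aq /(exponentsP _ _ BF)[f fB].
have sd : size (rn d A) = d by rewrite size_mkseq.
have BA : rn d (icat (rn d A) E) = rn d A by rewrite -{1}sd rn_icat.
have fd j : j < d -> f j = k by apply: exponents_above_depth fB.
have [fk [N fN] [n fn] f1 f2] := fB.
have [_ EF _] := (FINinf_icat _ _).1 BF.
have shift i : icat (rn d A) E (d + i) = E i.
  by have := icat_shift (rn d A) E i; rewrite sd.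
apply/(exponentsP _ _ EF); exists (fun i => f (d + i)); split=> [i||| |].
- by split=> //; have [] := fk (d + i).
- by exists N => i Ni; apply: fN; lia.
- exists (n - d); rewrite subnKC // leqNgt; apply/negP => /fd; lia.
- by move=> i m Em; rewrite (f1 (d + i)) shift.
- move=> m E0; have [[j Bj]|nB] := pselect (exists j, icat (rn d A) E j m != 0).
    rewrite (f1 _ _ Bj); have [jd|dj] := ltnP j d.
      by rewrite fd //; have := FINinf_le j m BF; lia.
    by move: Bj; rewrite -(subnKC dj) shift E0 eqxx.
  by apply: f2 => j; apply/eqP; apply: contra_notT nB => ?; exists j.
Qed.

(** The blocks of [E] lie past [a], so they use none of the first [d] blocks of [B]. They are
    combinations of later blocks and hence lie past the first [d], which [A] and [B] share. *)
Lemma FINinf_icat_depth A B a E : FINinf k A -> FINinf k B -> FINinf k E ->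
  FINfin_below k A a -> rn (depth k A a) B = rn (depth k A a) A ->
  below k E B -> (forall p n, p \in a -> block_lt p (E n)) ->
  FINinf k (icat (rn (depth k A a) A) E).
Proof.
set d := depth k A a => AF BF EF aA e EB aE; apply/FINinf_icat; split=> //.
  by have := AF; rewrite -{1}(icat_rn d A) => /FINinf_icat[].
rewrite -e => p n /(nthP zero_block)[j]; rewrite size_mkseq => jd <-.
rewrite nth_mkseq // => m x Bjm Enx.
have /(exponentsP _ _ BF)[f fE] : span k B (E n) by apply: EB; exists n.
have fd i : i < d -> f i = k.
  by apply: exponents_above_depth fE => // p' pa; apply: aE.
have [_ _ _ f1 f2] := fE.
have [[i Bix]|nB] := pselect (exists i, B i x != 0); last first.
  case: Enx; apply: f2 => i; apply/eqP.
  by apply: contra_notT nB => ?; exists i.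
have [id|di] := ltnP i d.
  by case: Enx; rewrite (f1 _ _ Bix) fd //; have := FINinf_le i x BF; lia.
by apply: (FINinf_lt BF (leq_trans jd di)) => //; apply/eqP.
Qed.

Lemma block_lt_span A p q : FINinf k A -> (forall n, block_lt p (A n)) ->
  span k A q -> block_lt p q.
Proof.
move=> AF pA /(exponentsP _ _ AF)[f [_ _ _ _ f0]] m x pm qx.
have [i Aix] : exists i, A i x <> 0.
  apply: contrapT => nA; apply: qx; apply: f0 => i.
  by apply: contrapT => ?; apply: nA; exists i.
exact: pA Aix.
Qed.

Lemma FINinf_ltxx A n : FINinf k A -> ~ block_lt (A n) (A n).
Proof.
move=> [/(_ n) /FIN_neq0[m Am] _] /(_ m m Am Am).
by rewrite ltnn.
Qed.

End Blocks.

(** * The order of $\mathbb M_{\mathcal H}$ *)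

Section Conditions.
Variables (k : nat) (H : set (nat -> block)).
Hypotheses (k_gt0 : 0 < k) (Hco : coideal k H).

Let HF A : H A -> FINinf k A.
Proof. exact: coideal_sub. Qed.

Lemma condition_FINinf (c : condition k H) : FINinf k (icat (stem c) (tail c)).
Proof.
apply/FINinf_icat => //; split; first exact: stem_fin.
  exact: HF (tail_in c).
by move=> p n; apply: stem_lt_tail.
Qed.

Lemma condition_ex t E : H E -> FINinf k (icat t E) ->
  exists c : condition k H, stem c = t /\ tail c = E.
Proof.
move=> HE /(FINinf_icat k_gt0)[tF EF tE].
by exists (Condition tF HE (fun p n => tE p n)).
Qed.

Lemma condition_le_cat (c d : condition k H) u : stem c = stem d ++ u ->
  (forall p, p \in u -> span k (tail d) p) -> below k (tail c) (tail d) ->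
  condition_le c d.
Proof.
move=> cu ud cd; split=> //; first by rewrite cu prefix_prefix.
by move=> p; rewrite cu mem_cat => /orP[->|/ud].
Qed.

(** The order controls only those blocks of [stem c] that do not occur in [stem d]. A block of [u]
    occurring in [stem d] as well would lie below itself. *)
Lemma condition_le_stem (c d : condition k H) : condition_le c d ->
  exists u, [/\ stem c = stem d ++ u, forall p, p \in u -> span k (tail d) p
              & below k (tail c) (tail d)].
Proof.
case=> /prefixP[u cu] cd ud; exists u; split=> // p pu; apply: ud.
  by rewrite cu mem_cat pu orbT.
have := condition_FINinf c; rewrite cu icatA => /(FINinf_icat k_gt0)[_ uF lt].
apply/negP => pd; move: pu => /(nthP zero_block)[i iu pi].
have e : icat u (tail c) i = p by rewrite icat_nth.
by apply: (FINinf_ltxx k_gt0 (n := i) uF); rewrite {1}e; apply: lt.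
Qed.

Lemma condition_le_refl (c : condition k H) : condition_le c c.
Proof. by apply: (@condition_le_cat _ _ [::]); rewrite ?cats0 //; apply: below_refl. Qed.

Lemma condition_le_trans (b c d : condition k H) :
  condition_le b c -> condition_le c d -> condition_le b d.
Proof.
move=> /condition_le_stem[u [bu uc bc]] /condition_le_stem[v [cv vd cd]].
have cF := HF (tail_in c); have dF := HF (tail_in d).
apply: (@condition_le_cat _ _ (v ++ u)); first by rewrite bu cv catA.
  move=> p; rewrite mem_cat => /orP[/vd//|/uc]; exact: span_trans.
by apply: below_trans cd => //; apply: HF (tail_in b).
Qed.

(** * Two applications of semiselectivity *)

Hypothesis Hss : semiselective k H.
Variable U : bool -> set (condition k H).
Hypothesis U_open : forall e c d, condition_le d c -> U e c -> U e d.
Hypothesis U_regular : forall e c,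
  (forall d, condition_le d c -> exists2 d', condition_le d' d & U e d') -> U e c.
Hypothesis U_dense : forall c, exists2 d, condition_le d c & exists e, U e d.

(** All tails below [B] are considered, since [B] itself need not lie past [s ++ a]. *)
Definition forced s e a B := forall c : condition k H,
  stem c = s ++ a -> below k (tail c) B -> U e c.

Lemma forced_below s e a A B : H A -> H B -> below k A B ->
  forced s e a B -> forced s e a A.
Proof.
move=> /HF AF /HF BF AB fB c ca cA; apply: fB => //.
by apply: below_trans AB => //; apply: HF (tail_in c).
Qed.

Lemma basicn_rn n A B : basicn k n A B -> rn n B = rn n A.
Proof.
case=> _ [m e] _; have := congr1 size e; rewrite !size_mkseq => mn.
by rewrite -{1}mn.
Qed.

Lemma basicnE n A B : FINinf k B -> below k B A -> rn n B = rn n A ->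
  basicn k n A B.
Proof. by split=> //; exists n. Qed.

(* Given some [c] with stem [s ++ a] and tail below [A1] in [U e], the witness of
   density is [icat (rn d A) (tail c)]: every condition with stem [s ++ a] and
   tail below it is stronger than [c]. *)
Lemma ex_fusion_decided s A : H A -> exists2 B, fam_below k H A B &
  forall b e (c : condition k H), stem c = s ++ b -> U e c ->
    (forall p, p \in b -> span k B p) -> below k (tail c) B ->
    exists e', forced s e' b B.
Proof.
move=> HA; have AF := HF HA.
(* The second alternative keeps [D a] dense where no condition with stem [s ++ a] decides. *)
pose D a := [set B | (H `&` basicn k (depth k A a) A) B /\
  ((exists e, forced s e a B) \/
   forall (c : condition k H) e, stem c = s ++ a -> below k (tail c) B -> ~ U e c)].
have Ddense a : FINfin_below k A a ->
    dense_open k (H `&` basicn k (depth k A a) A) (D a).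
  move=> aA; set d := depth k A a; split.
  - by move=> B [].
  - move=> A1 [HA1 bA1]; have A1F := HF HA1.
    have [_ _ A1A] := bA1; have rA1 := basicn_rn bA1.
    have [[c [e [ca cA1 Uc]]]|nU] := pselect (exists (c : condition k H) e,
        [/\ stem c = s ++ a, below k (tail c) A1 & U e c]); last first.
      exists A1; last exact: below_refl.
      by split=> //; right=> c e ca cA1 Uc; apply: nU; exists c, e.
    have above (c' : condition k H) n p : stem c' = s ++ a -> p \in a ->
        block_lt p (tail c' n).
      by move=> c'a pa; apply: stem_lt_tail; rewrite c'a mem_cat pa orbT.
    have BF : FINinf k (icat (rn d A) (tail c)).
      apply: FINinf_icat_depth cA1 _ => //; first exact: HF (tail_in c).
      by move=> p n; apply: above.
    have BA1 : below k (icat (rn d A) (tail c)) A1.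
      apply/below_icat; split=> // p /(nthP zero_block)[j].
      rewrite -rA1 size_mkseq => jd <-.
      by rewrite nth_mkseq //; apply: span_self.
    have BH : H (icat (rn d A) (tail c)).
      by apply: (coideal_up Hco (tail_in c) BF); apply: below_icatr.
    exists (icat (rn d A) (tail c)) => //; split.
      split=> //; apply: basicnE => //; first by apply: below_trans A1A.
      by have := rn_icat (rn d A) (tail c); rewrite {1}size_mkseq.
    (* The tail of [c'] lies past [a], so by [span_above_depth] it uses only blocks of [tail c]. *)
    left; exists e => c' c'a c'B; apply: U_open Uc.
    apply: (@condition_le_cat _ _ [::]) => //; first by rewrite cats0 ca c'a.
    move=> _ [n _ <-]; apply: (@span_above_depth _ k_gt0 A a) => //.
      by move=> p; apply: above.
    by apply: c'B; exists n.
  - move=> A1 B [HA1 bA1] [[HB bB] DB] A1B; split=> //.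
    case: DB => [[e fB]|nU]; first by left; exists e; apply: forced_below fB.
    right=> c e ca cA1; apply: nU => //.
    by apply: below_trans A1B => //; apply: HF => //; apply: tail_in.
have [B [HB BA] BD] := Hss HA Ddense (conj HA (@below_refl k A)).
exists B => // b e c cb Uc bB cB.
have basicB (c' : condition k H) : stem c' = s ++ b -> below k (tail c') B ->
    FINinf k (icat b (tail c')) /\ basic k b B (icat b (tail c')).
  move=> c'b c'B; have := condition_FINinf c'.
  by rewrite c'b icatA => /(FINinf_icat k_gt0)[_ h _]; split=> //; apply: basic_icat.
have [bE _] := basicB c cb cB.
have [Ab [_ DAb] BAb] := BD b (FINfin_below_icat k_gt0 bE bB cB).
(* Prolonging [b] by a tail below [B] gives a member of $[b,B]\subseteq[b,A_b]$, so that the tail is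
   below [Ab] too. *)
have belowAb (c' : condition k H) : stem c' = s ++ b -> below k (tail c') B ->
    below k (tail c') Ab.
  by move=> c'b c'B; have [_ /BAb[_ _ /below_icat[]]] := basicB c' c'b c'B.
case: DAb => [[e' fAb]|nU]; last by case: (nU c e cb (belowAb c cb cB) Uc).
by exists e' => c' c'b c'B; apply: fAb => //; apply: belowAb.
Qed.

(** Pigeonhole (d) treats one [a] and one [O e]. Homogeneity at [a] is inherited when $[a,B]$
    shrinks, so it survives the treatment of the other value of [e] and the diagonalisation over all
    [a]. *)
Lemma ex_fusion_homogeneous (O : bool -> set (seq block)) A : H A ->
  exists2 B, fam_below k H A B & forall e a, FINfin_below k B a ->
    rn (size a).+1 @` basic k a B `<=` O e \/
    rn (size a).+1 @` basic k a B `&` O e = set0.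
Proof.
move=> HA; have AF := HF HA.
pose hom e a B := rn (size a).+1 @` basic k a B `<=` O e \/
    rn (size a).+1 @` basic k a B `&` O e = set0.
have hom_below e a B C : basic k a B `<=` basic k a C -> hom e a C -> hom e a B.
  move=> BC; have BC' := image_subset (rn (size a).+1) BC.
  case=> [CO|CO]; first by left; apply: subset_trans CO.
  by right; rewrite -subset0 => x [/BC' ? ?]; rewrite -CO.
pose D a := (H `&` basicn k (depth k A a) A) `&` [set B | forall e, hom e a B].
have step e a A1 : FINfin_below k A a -> (H `&` basicn k (depth k A a) A) A1 ->
    exists2 B, (H `&` basicn k (depth k A a) A) B & below k B A1 /\ hom e a B.
  move=> aA SA1; have [HA1 bA1] := SA1; have A1F := HF HA1.
  have aA1 : FINfin_below k A1 a.
    by split; [case: aA|apply: (coideal_amalg1 Hco HA aA); split].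
  have dA1 : depth k A1 a = depth k A a.
    by apply: depth_rn => //; apply: basicn_rn.
  (* The intersection meets the form required by (d) and changes nothing on $r_{|a|+1}[a,B]$, whose
     members have this length. *)
  have [|B [bB HB] hB] := coideal_pigeon Hco (O := O e `&` FINlen k (size a).+1) HA1 aA1.
    exact: subIsetr.
  have BF := HF HB; have [_ _ BA1] := bB; have [_ _ A1A] := bA1.
  exists B.
    split=> //; apply: basicnE => //; first by apply: below_trans A1A.
    by rewrite -(basicn_rn bA1) -dA1 (basicn_rn bB).
  split=> //; case: hB => hB; [left=> x /hB[]|right] => //.
  rewrite -subset0 => x [xB Ox]; rewrite -hB; split=> //; split=> //.
  case: xB => C [CF _ _] <-; split; last by rewrite /rn /= size_map size_iota.
  by have := CF; rewrite -{1}(icat_rn (size a).+1 C) => /(FINinf_icat k_gt0)[].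
have Ddense a : FINfin_below k A a ->
    dense_open k (H `&` basicn k (depth k A a) A) (D a).
  move=> aA; split=> [B []//|A1 SA1|A1 B SA1 [[HB _] hB] A1B].
    have [B1 SB1 [B1A1 h1]] := step true a A1 aA SA1.
    have [B2 SB2 [B2B1 h2]] := step false a B1 aA SB1.
    have [[HA1 _] [HB1 _] [HB2 _]] := And3 SA1 SB1 SB2.
    exists B2; last by apply: below_trans B2B1 B1A1 => //; apply: HF.
    split=> // -[] //; apply: hom_below h1.
    by apply: basic_sub => //; apply: HF.
  split=> // e; apply: hom_below (hB e); have [HA1 _] := SA1.
  by apply: basic_sub => //; apply: HF.
have [B [HB BA] BD] := Hss HA Ddense (conj HA (@below_refl k A)).
exists B => // e a aB; have [Aa [_ hAa] sub] := BD a aB.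
exact: hom_below (hAa e).
Qed.

(** * Removing the blocks of a deciding extension *)

Lemma tail_shift E : H E -> H (fun n => E n.+1) /\ below k (fun n => E n.+1) E.
Proof.
move=> HE; have [EF Elt] := HF HE; split; last first.
  by move=> _ [n _ <-]; apply: span_self.
apply: (coideal_finite Hco HE); first by split.
apply: (sub_finite_set _ (finite_set1 (E 0))) => x [].
  by case=> -[[|n] _ <-] // []; exists n.
by case=> -[n _ <-] []; exists n.+1.
Qed.

Lemma pure_decision_regular (c : condition k H) :
  exists d : condition k H,
    [/\ stem d = stem c, below k (tail d) (tail c) & exists e, U e d].
Proof.
set s := stem c.
have [B1 [HB1 B1A] dec] := ex_fusion_decided s (tail_in c).
pose O e := [set b | forced s e b B1].
have [B2 [HB2 B2B1] hom] := ex_fusion_homogeneous O HB1.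
have B1F := HF HB1; have B2F := HF HB2.
have B2A : below k B2 (tail c) by apply: below_trans B1A => //; apply: HF (tail_in c).
have stem_cat (c' : condition k H) a : stem c' = s ++ a ->
    FINinf k (icat a (tail c')).
  by move=> c'a; have := condition_FINinf c'; rewrite c'a icatA => /(FINinf_icat k_gt0)[].
(* Induction on the length of the extension [b]. The value [e'] is not tied to [e]: only the
   existence of a decision is followed. *)
suff main n b (d : condition k H) e : size b = n -> stem d = s ++ b ->
    (forall p, p \in b -> span k B2 p) -> below k (tail d) B2 -> U e d ->
    exists e', forced s e' [::] B1.
  have [|d [ds dB2]] := @condition_ex s B2 HB2.
    apply/(FINinf_icat k_gt0); split=> //; first exact: stem_fin.
    move=> p n ps; apply: (block_lt_span k_gt0 (HF (tail_in c))).
      by move=> i; apply: stem_lt_tail.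
    by apply: B2A; exists n.
  have [d' d'd [e Ud']] := U_dense d.
  have [b [d'b bB2 d'B2]] := condition_le_stem d'd.
  rewrite ds in d'b; rewrite dB2 in bB2 d'B2.
  have [e' fe'] := main _ b d' e erefl d'b bB2 d'B2 Ud'.
  exists d; split=> //; first by rewrite dB2.
  by exists e'; apply: fe'; rewrite ?cats0 // dB2.
have sub12 := span_trans k_gt0 B2F B1F B2B1.
have below12 (E : condition k H) : below k (tail E) B2 -> below k (tail E) B1.
  by move=> EB2 q /EB2 /sub12.
elim: n b d e => [|n IHn] b d e.
  move=> /size0nil-> ds _ dB2 Ud; apply: dec Ud _ _ => //; exact: below12.
case/lastP: b => // a x; rewrite size_rcons => -[an] da aB2 dB2 Ud.
(* By the choice of [B1], the decision of the single condition [d] spreads to all conditions with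
   its stem and tail below [B1]. *)
have [e' fax] := dec _ e d da Ud (fun p pa => sub12 _ (aB2 p pa)) (below12 _ dB2).
have aB2' p : p \in a -> span k B2 p.
  by move=> pa; apply: aB2; rewrite mem_rcons inE pa orbT.
have next (d' : condition k H) y u : stem d' = s ++ (a ++ y :: u) ->
    (forall p, p \in y :: u -> span k B2 p) -> below k (tail d') B2 ->
    (rn (size a).+1 @` basic k a B2) (rcons a y).
  move=> d'y yB2 d'B2; exists (icat (a ++ y :: u) (tail d')).
    rewrite icatA; apply: basic_icat => //; first by rewrite -icatA; apply: stem_cat.
    exact/below_icat.
  by rewrite -cat_rcons icatA -(size_rcons a y) rn_icat.
have aB2F : FINfin_below k B2 a.
  apply: (@FINfin_below_icat _ k_gt0 _ (icat [:: x] (tail d))) => //.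
    by rewrite -icatA cats1; apply: stem_cat.
  apply/below_icat; split=> // p; rewrite inE => /eqP->; apply: aB2.
  by rewrite mem_rcons inE eqxx.
(* [rcons a x] rules out the disjoint alternative, so what holds for [x] holds for every [y]. *)
have Oa y : (rn (size a).+1 @` basic k a B2) (rcons a y) -> forced s e' (rcons a y) B1.
  case: (hom e' a aB2F) => [h /h//|h0 _].
  suff: (rn (size a).+1 @` basic k a B2 `&` O e') (rcons a x) by rewrite h0.
  split=> //; apply: (next d x [::]) => //; first by rewrite cats1.
  by move=> p; rewrite inE => /eqP->; apply: aB2; rewrite mem_rcons inE eqxx.
have [xd_F xdB2] : FINinf k (icat (s ++ a) (icat [:: x] (tail d))) /\
    below k (icat [:: x] (tail d)) B2.
  split; first by rewrite -icatA -catA cats1 -da; apply: condition_FINinf.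
  apply/below_icat; split=> // p; rewrite inE => /eqP->; apply: aB2.
  by rewrite mem_rcons inE eqxx.
(* The block [x] goes from the stem into the tail, which gives a condition [d1] with the shorter
   stem [s ++ a]. *)
have xdH : H (icat [:: x] (tail d)).
  have [_ h _] := (FINinf_icat k_gt0 _ _).1 xd_F.
  by apply: (coideal_up Hco (tail_in d)) => //; apply: below_icatr.
have [d1 [d1s d1x]] := condition_ex xdH xd_F.
apply: (IHn a d1 e') => //; first by rewrite d1x.
(* By regularity it is enough that [U e'] is dense below [d1]. *)
apply: U_regular => d2 /condition_le_stem[u [d2u uB2 d2B2]].
have d1B2 : below k (tail d1) B2 by rewrite d1x.
have d1F := HF (tail_in d1).
have {}uB2 p : p \in u -> span k B2 p.
  by move=> /uB2; apply: span_trans.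
have {}d2B2 : below k (tail d2) B2.
  by apply: below_trans d1B2 => //; apply: HF (tail_in d2).
(* The extension [d2] may have the same stem as [d1]; in that case the first block of its tail is
   appended to the stem. *)
have [d3 [y [v [d32 d3v vB2 d3B2]]]] : exists d3 y v,
    [/\ condition_le d3 d2, stem d3 = s ++ (a ++ y :: v),
      forall p, p \in y :: v -> span k B2 p & below k (tail d3) B2].
  case: u d2u uB2 => [|y v] d2u uB2; last first.
    by exists d2, y, v; split=> //; [apply: condition_le_refl|rewrite d2u d1s catA].
  have [SH SE] := tail_shift (tail_in d2); have E0 := @span_self k (tail d2) 0.
  have [|d3 [d3s d3E]] := @condition_ex (stem d2 ++ [:: tail d2 0]) _ SH.
    have -> : icat (stem d2 ++ [:: tail d2 0]) (fun n => tail d2 n.+1) =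
              icat (stem d2) (tail d2).
      by rewrite icatA; congr icat; apply: (icat_rn 1).
    exact: condition_FINinf.
  exists d3, (tail d2 0), [::]; split.
  - apply: condition_le_cat d3s _ _; last by rewrite d3E.
    by move=> p; rewrite inE => /eqP->.
  - by rewrite d3s d2u d1s cats0 catA.
  - by move=> p; rewrite inE => /eqP->; apply: d2B2; exists 0.
  - by rewrite d3E => q /SE; apply: span_trans => //; apply: HF (tail_in d2).
exists d3 => //.
(* Cutting the stem of [d3] after [y] and returning [v] to the tail gives a condition [d4] weaker
   than [d3]. It lies in [U e'] by [Oa], and hence so does [d3]. *)
have [vF vB] : FINinf k (icat (s ++ rcons a y) (icat v (tail d3))) /\
    below k (icat v (tail d3)) B2.
  split; first by rewrite -icatA -catA cat_rcons -d3v; apply: condition_FINinf.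
  by apply/below_icat; split=> // p pv; apply: vB2; rewrite inE pv orbT.
have vH : H (icat v (tail d3)).
  have [_ h _] := (FINinf_icat k_gt0 _ _).1 vF.
  by apply: (coideal_up Hco (tail_in d3)) => //; apply: below_icatr.
have [d4 [d4s d4v]] := condition_ex vH vF.
have Ud4 : U e' d4.
  apply: (Oa y) => //; first exact: next d3v vB2 d3B2.
  by apply: below12; rewrite d4v.
apply: U_open Ud4; apply: (@condition_le_cat _ _ v).
- by rewrite d4s d3v -catA cat_rcons.
- move=> p /(nthP zero_block)[i iv <-]; rewrite d4v -(icat_nth (tail d3) iv).
  exact: span_self.
- by rewrite d4v; apply: below_icatr.
Qed.

End Conditions.

Theorem theorem7p3 (k : nat) (H : set (nat -> block)) :
  1 <= k -> coideal k H -> semiselective k H -> pure_decision k H.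
Proof.
move=> k0 Hco Hss f c.
have refl := @condition_le_refl k H.
have trans := @condition_le_trans k H k0 Hco.
pose U (e : bool) : set (condition k H) :=
  [set d | forces (@condition_le k H) d (if e then f else FNot f)].
have [||c'|d [dc dt [e Ud]]] := @pure_decision_regular k H k0 Hco Hss U _ _ _ c.
- by move=> e c' d dc; apply: forces_in_le.
- by move=> e c' h; apply: forces_in_dense.
- have [d dc' [fd|fd]] := decides_dense refl f c'; exists d => //.
    by exists true.
  by exists false.
- by exists d; split=> //; case: e Ud; [left|right].
Qed.
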